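(* Let $R$ be a ring, let $\{N_1,\dots,N_k\}$ be a collection of ideals of $R$ satisfying the CNC-condition, and let $s_i$ be the characteristic of $N_i$ in $N_{i+1}$ ($i=1,\dots,k-1$). Then: (1) If $w$ is a natural number with $(x+N_1)^w=1+N_1$ for all $x+N_1\in (R/N_1)^*$, then $x^{w s_1\cdots s_{k-1}}=1$ for all $x\in R^*$. (2) If $(R/N_1)^*$ is finite, then $x^{|(R/N_1)^*|\, s_1\cdots s_{k-1}}=1$ for all $x\in R^*$. (3) If $R^*$ is finite, then $x^{|(R/N_1)^*|\,|N_1|}=1$ for all $x\in R^*$.
   Context: Rings are associative with identity, not necessarily commutative; $S^*$ denotes the group of units of a ring $S$. A collection $\{N_1,\dots,N_k\}$ of ideals of $R$ satisfies the CNC-condition if: (i) $\{0\}=N_k\subset N_{k-1}\subset\cdots\subset N_1\subset R$; (ii) for each $i=1,\dots,k-1$ there is $t_i\ge 2$ with $N_i^{t_i}\subset N_{i+1}$ (the minimal such $t_i$ is the nilpotency index of $N_i$ in $N_{i+1}$); (iii) for each $i=1,\dots,k-1$ there is $s_i\ge 1$ with $s_iN_i\subset N_{i+1}$ and all prime factors of $s_i$ are $\ge t_i$; the minimal such $s_i$ is called the characteristic of $N_i$ in $N_{i+1}$. *)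

(* Defs.v *)
From HB Require Import structures.
From mathcomp Require Import all_boot all_algebra finmap.
From mathcomp Require Import boolp classical_sets cardinality.

Set Implicit Arguments.
Unset Strict Implicit.
Unset Printing Implicit Defensive.

Import GRing.Theory.
Local Open Scope classical_set_scope.
Local Open Scope ring_scope.
Local Open Scope quotient_scope.

(* [pzRingType] is the class of associative rings with identity, neither
   commutative nor nonzero in general; unlike [unitRingType] it carries no unit
   predicate. *)
Definition units (S : pzRingType) : set S :=
  [set x | exists y : S, x * y = 1 /\ y * x = 1].

Arguments units : clear implicits.

(* Meaningful for finite sets only: the value is 0 on infinite ones. *)
Definition set_card (T : choiceType) (A : set T) : nat := #|` fset_set A |.

Record ideal (R : pzRingType) := Ideal {
  ideal_set :> set R;
  ideal0 : ideal_set 0;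
  idealB : forall x y, ideal_set x -> ideal_set y -> ideal_set (x - y);
  idealMl : forall a x, ideal_set x -> ideal_set (a * x);
  idealMr : forall a x, ideal_set x -> ideal_set (x * a) }.

(* The library has the quotient of an additive group by a subgroup, but a ring
   structure on it only for commutative rings; the instances below supply the
   noncommutative, possibly trivial, case. *)
Section Quotient.
Variables (R : pzRingType) (I : ideal R).

Definition ideal_pred : {pred R} := fun x => `[< ideal_set I x >].

Fact ideal_zmod_closed : zmod_closed ideal_pred.
Proof.
split=> [|x y /asboolP Ix /asboolP Iy]; apply/asboolP; first exact: ideal0.
exact: idealB.
Qed.

HB.instance Definition _ := GRing.isZmodClosed.Build R ideal_pred
  ideal_zmod_closed.

Definition quot_ring := Quotient.quot ideal_pred.

HB.instance Definition _ := GRing.Zmodule.on quot_ring.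

Definition residue (x : R) : quot_ring := \pi_(Quotient.quot ideal_pred) x.

Lemma residue_eq (x y : R) : residue x = residue y <-> ideal_set I (x - y).
Proof.
split=> [xy|Ixy].
  by apply/asboolP; move/eqP: xy; rewrite /residue piE Quotient.equivE.
by apply/eqP; rewrite /residue piE Quotient.equivE; apply/asboolP.
Qed.

Lemma residue_surj (u : quot_ring) : exists x, residue x = u.
Proof. by exists (repr u); exact: reprK. Qed.

Definition quot_ring_mul (u v : quot_ring) : quot_ring :=
  residue (repr u * repr v).

Lemma residue_mul (x y : R) :
  quot_ring_mul (residue x) (residue y) = residue (x * y).
Proof.
apply/residue_eq; set x' := repr _; set y' := repr _.
have Ix : ideal_set I (x' - x) by apply/residue_eq; exact: reprK.
have Iy : ideal_set I (y' - y) by apply/residue_eq; exact: reprK.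
have -> : x' * y' - x * y = (x' - x) * y' - x * (y - y').
  by rewrite mulrBl mulrBr opprB addrA addrNK.
by apply: idealB; [exact: idealMr | apply: idealMl; rewrite -opprB -sub0r;
  apply: idealB => //; exact: ideal0].
Qed.

Lemma residue_add (x y : R) : residue x + residue y = residue (x + y).
Proof. by apply/esym; exact: (Quotient.pi_add ideal_pred). Qed.

Fact quot_ring_mulA : associative quot_ring_mul.
Proof.
move=> u v w; have [x <-] := residue_surj u; have [y <-] := residue_surj v.
by have [z <-] := residue_surj w; rewrite !residue_mul mulrA.
Qed.

Fact quot_ring_mul1l : left_id (residue 1) quot_ring_mul.
Proof.
by move=> u; have [x <-] := residue_surj u; rewrite residue_mul mul1r.
Qed.

Fact quot_ring_mul1r : right_id (residue 1) quot_ring_mul.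
Proof.
by move=> u; have [x <-] := residue_surj u; rewrite residue_mul mulr1.
Qed.

Fact quot_ring_mulDl : left_distributive quot_ring_mul +%R.
Proof.
move=> u v w; have [x <-] := residue_surj u; have [y <-] := residue_surj v.
by have [z <-] := residue_surj w; rewrite !(residue_mul, residue_add) mulrDl.
Qed.

Fact quot_ring_mulDr : right_distributive quot_ring_mul +%R.
Proof.
move=> u v w; have [x <-] := residue_surj u; have [y <-] := residue_surj v.
by have [z <-] := residue_surj w; rewrite !(residue_mul, residue_add) mulrDr.
Qed.

HB.instance Definition _ := GRing.Zmodule_isPzRing.Build quot_ring
  quot_ring_mulA quot_ring_mul1l quot_ring_mul1r
  quot_ring_mulDl quot_ring_mulDr.

Fact residue_is_zmod_morphism : zmod_morphism residue.
Proof.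
move=> x y; apply: (addIr (residue y)); rewrite addrNK.
by rewrite residue_add addrNK.
Qed.

HB.instance Definition _ := GRing.isZmodMorphism.Build R quot_ring residue
  residue_is_zmod_morphism.

Fact residue_is_monoid_morphism : monoid_morphism residue.
Proof. by split=> // x y; rewrite -residue_mul. Qed.

HB.instance Definition _ := GRing.isMonoidMorphism.Build R quot_ring residue
  residue_is_monoid_morphism.

End Quotient.

Section Chains.
Variable R : pzRingType.
Implicit Types (I J : set R) (s t : nat).

Definition ideal_prod I J : set R :=
  [set x | exists r : seq (R * R),
     (forall p, p \in r -> I p.1 /\ J p.2) /\ x = \sum_(p <- r) p.1 * p.2].

(* [ideal_pow I 0] is the whole ring, hence [ideal_pow I 1 = I] for an ideal I. *)
Definition ideal_pow I (n : nat) : set R := iter n (ideal_prod I) setT.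

Definition least (P : nat -> Prop) (n : nat) : Prop :=
  P n /\ forall m, P m -> (n <= m)%N.

Definition nilpotent_bound I J t : Prop := (2 <= t)%N /\ ideal_pow I t `<=` J.

Definition nilpotency_index_in I J t : Prop := least (nilpotent_bound I J) t.

Definition char_bound I J t s : Prop :=
  [/\ (1 <= s)%N,
      [set x *+ s | x in I] `<=` J
    & forall p, prime p -> (p %| s)%N -> (t <= p)%N].

(* The value does not depend on the choice of an admissible t: the s >= 1 with
   s I included in J are the multiples of the least one, so its prime factors
   are among those of any other. *)
Definition characteristic_in I J s : Prop :=
  exists t, nilpotency_index_in I J t /\ least (char_bound I J t) s.

(* The collection {N_1, ..., N_k} is given by the values of [N] at 1, ..., k. *)
Definition CNC (k : nat) (N : nat -> ideal R) : Prop :=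
  [/\ (1 <= k)%N,
      N k = [set 0] :> set R,
      forall i, (1 <= i < k)%N -> N i.+1 `<=` N i
    & forall i, (1 <= i < k)%N ->
        exists t, nilpotent_bound (N i) (N i.+1) t /\
          exists s, char_bound (N i) (N i.+1) t s].

End Chains.

(* Main.v *)
Require Import Defs.
From mathcomp Require Import all_boot all_algebra fingroup perm cyclic finmap.
From mathcomp Require Import boolp classical_sets cardinality.

(** Let [t] and [s] be the nilpotency index and the characteristic of [N i] in
    [N i.+1].  For [z] in [N i], all terms but the first of the binomial
    expansion of [(1 + z) ^ s] lie in [N i.+1]: for [j >= t] because [z ^ j]
    does, and for [0 < j < t] because [j] is coprime to [s], so that [s] divides
    ['C(s, j)].  Hence [y |-> y ^ s] maps [1 + N i] into [1 + N i.+1], and the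
    product of the characteristics kills [1 + N 1], which contains the [w]-th
    power of every unit.  Since [N 1] is nil, [1 + N 1] is a group of units, of
    order [|N 1|], and units of the quotient by [N 1] lift to units; the finite
    cases then follow from Lagrange's theorem. *)

Set Implicit Arguments.
Unset Strict Implicit.
Unset Printing Implicit Defensive.

Import GRing.Theory.
Local Open Scope classical_set_scope.
Local Open Scope ring_scope.

Lemma nat_range_ind (P : nat -> Prop) (m n : nat) : (m <= n)%N -> P m ->
  (forall i, (m <= i < n)%N -> P i -> P i.+1) -> P n.
Proof.
move=> mn Pm PS; elim: n mn PS => [|n IHn].
  by rewrite leqn0 => /eqP <-.
rewrite leq_eqVlt ltnS => /predU1P[<- //|mn PS].
apply: (PS); first by rewrite mn leqnn.
by apply: IHn => // i /andP[mi lt_in]; apply: PS; rewrite mi ltnS ltnW.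
Qed.

Lemma coprime_dvdn_bin (n m : nat) :
  (0 < m)%N -> coprime n m -> (n %| 'C(n, m))%N.
Proof.
case: m => // m _ nm; rewrite -(Gauss_dvdr _ nm) -mul_bin_diag.
exact: dvdn_mulr.
Qed.

Lemma coprime_lt_prime_divisors (n t m : nat) :
  (0 < n)%N -> (forall p, prime p -> (p %| n)%N -> (t <= p)%N) ->
  (0 < m < t)%N -> coprime n m.
Proof.
move=> n_gt0 le_t /andP[m_gt0 mt].
apply: (@pnat_coprime [pred p | (t <= p)%N]); first exact/pnatP.
apply/pnatP => // p _ /(dvdn_leq m_gt0) pm.
by rewrite inE /= unfold_in -ltnNge (leq_ltn_trans pm mt).
Qed.

Lemma set_card_image_inj (T U : choiceType) (f : T -> U) (A : set T) :
  injective f -> finite_set A -> set_card (f @` A) = set_card A.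
Proof.
by move=> f_inj finA; rewrite /set_card fset_set_image // card_imfset.
Qed.

(* Cayley's embedding [x |-> mul^~ x] turns this into Lagrange's theorem for
   permutation groups. *)
Lemma iter_mul_card (T : finType) (mul : T -> T -> T) (one x : T) :
    associative mul -> left_id one mul -> right_id one mul ->
  left_injective mul -> iter #|T| (mul^~ x) one = one.
Proof.
move=> mulA mul1m mulm1 mulI; pose cayley y := perm (@mulI y).
have cayley_inj : injective cayley.
  by move=> y z /permP/(_ one); rewrite !permE !mul1m.
have cayley_group : group_set (cayley @: T).
  apply/group_setP; split=> [|_ _ /imsetP[y _ ->] /imsetP[z _ ->]].
    apply/imsetP; exists one => //.
    by apply/permP => y; rewrite perm1 permE mulm1.
  apply/imsetP; exists (mul y z) => //.
  by apply/permP => u; rewrite permM !permE mulA.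
have := @expg_cardG _ (Group cayley_group) (cayley x) (imset_f _ isT).
rewrite /= card_imset // => /permP/(_ one); rewrite permX perm1 => {2}<-.
by apply: eq_iter => y; rewrite permE.
Qed.

Section Units.
Variable S : pzRingType.
Implicit Types (A : set S) (x y z : S).

Lemma units1 : units S 1.
Proof. by exists 1; rewrite mulr1. Qed.

Lemma unitsM x y : units S x -> units S y -> units S (x * y).
Proof.
case=> x' [xx' x'x] [y' [yy' y'y]]; exists (y' * x').
by rewrite !mulrA -(mulrA x) -(mulrA y') yy' x'x !mulr1.
Qed.

Lemma units_of_unitsM x y : units S (x * y) -> units S (y * x) -> units S x.
Proof.
case=> a [xya _] [b [_ byx]]; exists (y * a); rewrite mulrA; split=> //.
by rewrite -[y]mul1r -byx !mulrA -(mulrA _ x y) -(mulrA _ _ a) xya mulr1.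
Qed.

Lemma units_rreg x : units S x -> GRing.rreg x.
Proof.
by case=> x' [xx' _] y z /(congr1 ( *%R^~ x')); rewrite -!mulrA xx' !mulr1.
Qed.

Lemma expr_set_card A x : finite_set A -> A `<=` units S -> A 1 ->
  (forall y z, A y -> A z -> A (y * z)) -> A x -> x ^+ set_card A = 1.
Proof.
move=> finA unitsA A1 AM Ax; pose T : finType := fset_set A.
have memT y : (y \in fset_set A) = (y \in A) := in_fset_set finA y.
have AT (a : T) : A (val a) by apply/set_mem; rewrite -memT fsvalP.
have T1 : 1 \in fset_set A by rewrite memT mem_set.
have Tx : x \in fset_set A by rewrite memT mem_set.
have TM (a b : T) : val a * val b \in fset_set A.
  by rewrite memT; apply/mem_set/AM.
pose one : T := [` T1]%fset; pose mulT (a b : T) : T := [` TM a b]%fset.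
have iter_mulT n : val (iter n (mulT^~ [` Tx]%fset) one) = x ^+ n.
  by elim: n => [//|n IHn]; rewrite exprSr -IHn.
rewrite /set_card cardfE -iter_mulT iter_mul_card // => [a b c|a|a|a b c].
- by apply: val_inj; rewrite /= mulrA.
- by apply: val_inj; rewrite /= mul1r.
- by apply: val_inj; rewrite /= mulr1.
- by move/(congr1 val)/(units_rreg (unitsA _ (AT a)))/val_inj.
Qed.

Lemma expr_card_units x :
  finite_set (units S) -> units S x -> x ^+ set_card (units S) = 1.
Proof.
by move=> finU; apply: expr_set_card => //; [exact: units1|exact: unitsM].
Qed.

Lemma units_add1_nilpotent n z : z ^+ n = 0 -> units S (1 + z).
Proof.
move=> zn0; set geom := \sum_(i < n) (- z) ^+ i; exists geom.
have geomK : (1 + z) * geom = 1.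
  rewrite -[1 + z]opprK opprD addrC mulNr -subrX1.
  by rewrite exprNn zn0 mulr0 sub0r opprK.
split=> //; rewrite -[RHS]geomK; apply/esym/commr_sum => i _.
by apply/commrX/commrN/commr_sym/commrD; [exact: commr1|].
Qed.

Lemma expr_add1_nilpotent s t z :
    (0 < s)%N -> (forall p, prime p -> (p %| s)%N -> (t <= p)%N) ->
  z *+ s = 0 -> z ^+ t = 0 -> (1 + z) ^+ s = 1.
Proof.
move=> s_gt0 ps zs0 zt0; rewrite (exprDn_comm _ (commr_sym (commr1 z))).
rewrite big_ord_recl expr1n mul1r bin0 big1 ?addr0 // => i _.
rewrite expr1n mul1r; set j := lift _ _; have [tj|jt] := leqP t j.
  by rewrite -(subnK tj) exprD zt0 mulr0 mul0rn.
have /dvdnP[c ->] : (s %| 'C(s, j))%N.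
  exact/coprime_dvdn_bin/(coprime_lt_prime_divisors s_gt0 ps).
by rewrite exprS mulnC mulrnA -mulrnAl zs0 mul0r mul0rn.
Qed.

End Units.

Lemma residue_eq0 (R : pzRingType) (I : ideal R) (x : R) :
  residue I x = 0 <-> ideal_set I x.
Proof. by rewrite -(rmorph0 (residue I)) residue_eq subr0. Qed.

Lemma residue_units (R : pzRingType) (I : ideal R) (x : R) :
  units R x -> units (quot_ring I) (residue I x).
Proof.
by case=> y [xy yx]; exists (residue I y); rewrite -!rmorphM xy yx rmorph1.
Qed.

Lemma ideal_powX (R : pzRingType) (A : set R) (x : R) (n : nat) :
  A x -> ideal_pow A n (x ^+ n).
Proof.
move=> Ax; elim: n => [//|n IHn].
exists [:: (x, x ^+ n)]; split=> [p|]; last by rewrite big_seq1 exprS.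
by rewrite inE => /eqP ->.
Qed.

Section OnePlus.
Variable R : pzRingType.
Implicit Types (I J : ideal R) (x : R).

Definition one_plus I : set R := [set 1 + z | z in ideal_set I].

Lemma one_plusP I x : one_plus I x <-> residue I x = 1.
Proof.
split=> [[z /residue_eq0 Iz <-]|x1].
  by rewrite rmorphD rmorph1 /= Iz addr0.
exists (x - 1); last by rewrite subrKC.
by apply/residue_eq0; rewrite rmorphB rmorph1 /= x1 subrr.
Qed.

Lemma one_plus1 I : one_plus I 1.
Proof. by apply/one_plusP; rewrite rmorph1. Qed.

Lemma one_plusM I x y : one_plus I x -> one_plus I y -> one_plus I (x * y).
Proof.
move=> /one_plusP x1 /one_plusP y1; apply/one_plusP.
by rewrite rmorphM /= x1 y1 mulr1.
Qed.

Lemma one_plus_set0 I : I = [set 0] :> set R -> one_plus I = [set 1].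
Proof. by rewrite /one_plus => ->; rewrite image_set1 addr0. Qed.

Lemma set_card_one_plus I :
  finite_set I -> set_card (one_plus I) = set_card I.
Proof. exact/set_card_image_inj/addrI. Qed.

Lemma one_plus_expr_units I w x :
    (forall u, units (quot_ring I) u -> u ^+ w = 1) ->
  units R x -> one_plus I (x ^+ w).
Proof.
by move=> uw1 /(residue_units I) /uw1; rewrite -rmorphXn => /one_plusP.
Qed.

Lemma one_plus_expr_char I J t s x :
    nilpotent_bound I J t -> char_bound I J t s ->
  one_plus I x -> one_plus J (x ^+ s).
Proof.
move=> [_ ItJ] [s_gt0 sIJ ps] [z Iz <-]; apply/one_plusP.
rewrite rmorphXn rmorphD rmorph1; apply: (expr_add1_nilpotent s_gt0 ps).
  by rewrite -rmorphMn; apply/residue_eq0/sIJ; exists z.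
by rewrite -rmorphXn; apply/residue_eq0/ItJ/ideal_powX.
Qed.

Definition nil_ideal I : Prop :=
  forall x, ideal_set I x -> exists n, x ^+ n = 0.

Section NilIdeal.
Variable I : ideal R.
Hypothesis nilI : nil_ideal I.

Lemma units_one_plus : one_plus I `<=` units R.
Proof. by move=> _ [z /nilI[n zn0] <-]; exact: units_add1_nilpotent zn0. Qed.

Lemma residue_units_nil x : units (quot_ring I) (residue I x) -> units R x.
Proof.
case=> v []; have [y <-] := residue_surj v; rewrite -!rmorphM.
move=> /one_plusP/units_one_plus xyU.
by move=> /one_plusP/units_one_plus/(units_of_unitsM xyU).
Qed.

Lemma finite_units_quot_nil :
  finite_set (units R) -> finite_set (units (quot_ring I)).
Proof.
move=> finU; apply: sub_finite_set (finite_image (residue I) finU) => u.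
by have [x <-] := residue_surj u => /residue_units_nil; exists x.
Qed.

Lemma finite_nil_ideal : finite_set (units R) -> finite_set I.
Proof.
move=> finU; rewrite -(eq_finite_set (inj_card_eq (in2W (addrI 1)))).
exact: sub_finite_set units_one_plus finU.
Qed.

Lemma expr_card_nil_ideal x :
  finite_set I -> one_plus I x -> x ^+ set_card I = 1.
Proof.
move=> finI; rewrite -set_card_one_plus //; apply: expr_set_card => //.
- exact: finite_image.
- exact: units_one_plus.
- exact: one_plus1.
- exact: one_plusM.
Qed.

End NilIdeal.
End OnePlus.

Section CNC.
Variables (R : pzRingType) (k : nat) (N : nat -> ideal R).
Hypothesis cncN : CNC k N.

Lemma CNC_nil : nil_ideal (N 1%N).
Proof.
have [k_gt0 Nk0 _ boundN] := cncN; move=> x Nx.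
pose nil_mod i := exists n, ideal_set (N i) (x ^+ n).
suff: nil_mod k by rewrite /nil_mod Nk0.
apply: (nat_range_ind k_gt0) => [|i /boundN[t [[_ NtN] _]] [n Nxn]].
  by exists 1%N.
by exists (n * t)%N; rewrite exprM; apply/NtN/ideal_powX.
Qed.

Lemma CNC_expr_prod_char (s : nat -> nat) (x : R) :
    (forall i, (1 <= i < k)%N -> characteristic_in (N i) (N i.+1) (s i)) ->
  one_plus (N 1%N) x -> x ^+ (\prod_(1 <= i < k) s i)%N = 1.
Proof.
move=> charN Nx; have [k_gt0 Nk0 _ _] := cncN.
pose in_one_plus i := one_plus (N i) (x ^+ (\prod_(1 <= j < i) s j)).
suff: in_one_plus k by rewrite /in_one_plus one_plus_set0.
apply: (nat_range_ind k_gt0) => [|i ik Nxi].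
  by rewrite /in_one_plus big_geq.
have [t [[tN _] [sN _]]] := charN i ik; have /andP[i_gt0 _] := ik.
rewrite /in_one_plus big_nat_recr //= exprM.
exact: one_plus_expr_char tN sN Nxi.
Qed.

End CNC.

Theorem theorem3p2 (R : pzRingType) (k : nat) (N : nat -> ideal R)
    (s : nat -> nat) (hN : CNC k N)
    (hs : forall i, (1 <= i < k)%N -> characteristic_in (N i) (N i.+1) (s i)) :
  (forall w : nat,
     (forall u : quot_ring (N 1%N), units (quot_ring (N 1%N)) u -> u ^+ w = 1) ->
     forall x : R, units R x -> x ^+ (w * \prod_(1 <= i < k) s i)%N = 1) /\
  (finite_set (units (quot_ring (N 1%N))) ->
     forall x : R, units R x ->
       x ^+ (set_card (units (quot_ring (N 1%N)))
             * \prod_(1 <= i < k) s i)%N = 1) /\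
  (finite_set (units R) ->
     [/\ finite_set (units (quot_ring (N 1%N))), finite_set (N 1%N)
       & forall x : R, units R x ->
           x ^+ (set_card (units (quot_ring (N 1%N))) * set_card (N 1%N))%N = 1]).
Proof.
have nilN := CNC_nil hN.
have exprU w : (forall u, units (quot_ring (N 1%N)) u -> u ^+ w = 1) ->
    forall x, units R x -> x ^+ (w * \prod_(1 <= i < k) s i)%N = 1.
  move=> uw1 x xU; rewrite exprM.
  exact: (CNC_expr_prod_char hN hs (one_plus_expr_units uw1 xU)).
split=> //; split=> [finQ|finU].
  by apply: exprU => u; exact: expr_card_units.
have finQ := finite_units_quot_nil nilN finU.
have finN := finite_nil_ideal nilN finU.
split=> // x xU; rewrite exprM; apply: expr_card_nil_ideal => //.
by apply: one_plus_expr_units xU => u; exact: expr_card_units.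
Qed.
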